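(* Let $X$ be a Hausdorff space. Then $X$ is a Čech-complete Lindelöf space if and only if there is a sequence $f_0\ge f_1\ge\ldots$ of continuous functions $f_n:X\to I$ converging pointwise to zero but not converging uniformly on any closed non-compact set in $X$.
   Context: $I=[0,1]$. Topological terminology is as in Engelking's ''General Topology'': a Čech-complete space is a Tychonoff (completely regular Hausdorff) space which is a $G_\delta$-set in its Čech–Stone compactification (equivalently, in some compactification); a Lindelöf space is a regular space every open cover of which has a countable subcover. *)

(* Defs.v *)
From HB Require Import structures.
From mathcomp Require Import all_boot all_order all_algebra.
From mathcomp Require Import all_classical all_reals all_analysis.
From mathcomp Require Import borel_hierarchy.

Set Implicit Arguments.
Unset Strict Implicit.
Unset Printing Implicit Defensive.

Import Order.TTheory GRing.Theory Num.Theory.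
Import numFieldNormedType.Exports.

Local Open Scope classical_set_scope.
Local Open Scope ring_scope.

(* [completely_regular_space] is phrased with uniform separators; by
   [uniform_separatorP] this is separation of a point and a closed set by a
   continuous function into [0, 1]. *)
Definition tychonoff_space (X : topologicalType) : Prop :=
  hausdorff_space X /\ completely_regular_space X.

Definition topological_embedding (X Y : topologicalType) (c : X -> Y) : Prop :=
  [/\ continuous c, injective c &
      forall U : set X, open U ->
        exists2 V : set Y, open V & c @` U = V `&` range c].

Definition compactification (X K : topologicalType) (c : X -> K) : Prop :=
  [/\ compact [set: K], hausdorff_space K,
      topological_embedding c & dense (range c)].

(* The largest compactification, for the order in which c' is below c when c'
   factors through c by a continuous map. It is unique up to homeomorphism. *)
Definition cech_stone_compactification
    (X K : topologicalType) (c : X -> K) : Prop :=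
  compactification c /\
  forall (K' : topologicalType) (c' : X -> K'), compactification c' ->
    exists2 h : K -> K', continuous h & forall x, h (c x) = c' x.

Definition cech_complete_space (X : topologicalType) : Prop :=
  tychonoff_space X /\
  exists (K : topologicalType) (c : X -> K),
    cech_stone_compactification c /\ Gdelta (range c).

(* A regular space is by convention T1; Hausdorff is equivalent to T1 in the
   presence of [regular_space], which does not itself include T1. *)
Definition lindelof_space (X : topologicalType) : Prop :=
  [/\ hausdorff_space X, @regular_space X &
      forall C : set (set X), (forall U, C U -> open U) ->
        [set: X] `<=` \bigcup_(U in C) U ->
        exists D : set (set X),
          [/\ D `<=` C, countable D & [set: X] `<=` \bigcup_(U in D) U]].

(* Main.v *)
Require Import Defs.
From HB Require Import structures.
From mathcomp Require Import all_boot all_order all_algebra.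
From mathcomp Require Import all_classical all_reals all_analysis.
From mathcomp Require Import lra.

(** Suppose first that X is Čech-complete and Lindelöf, embedded by c in a
  compactification K with range c the intersection of open sets U_k. By the
  Lindelöf property each U_k can be shrunk to a cozero set of K that still
  contains range c ([cozero_of_open]): there is a continuous h_k from K to
  [0, 1] that is positive on range c and zero outside U_k. The functions
      f_m x = sup_k (k + 1)^-1 * max (0, 1 - m * h_k (c x))
  are continuous and decrease to 0. If they converge uniformly on A, then each
  h_k is bounded away from 0 on c(A), so the closure of c(A) in K meets no
  zero set of an h_k, hence lies in range c. When A is closed in X this makes A
  compact ([seq_of_cech_complete_lindelof]).

  Conversely, let f_n decrease to 0 pointwise, and suppose that closed sets
  of uniform convergence are compact. The key fact, [cluster_of_cvg_values], is
  that a proper filter F along which every f_n has a limit z_n, with z_n tending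
  to 0, has a cluster point. In other words the map (f_n) is perfect from X to
  the space of decreasing null sequences. For the proof, the fibre
  C = {x | f_n x = z_n for all n} is compact, so if F has no cluster point, some
  A in F has a closure disjoint from C. A sequence x_k in A with
  f_n (x_k) --> z_n for all n is a set of uniform convergence; its closure is
  compact, and any cluster point of the sequence lies in C and in the closure
  of A, a contradiction.

  Applied to suitable filters, the key fact gives regularity
  ([regular_of_cluster]) and the Lindelöf property
  ([countable_subcover_of_cluster]), hence normality and complete regularity.
  Each f_n extends to the Čech-Stone compactification, and applied to the traces
  on X of neighbourhood filters the key fact shows that X consists of the points
  where the extensions tend to 0, which is a G_delta set. *)

Import Order.TTheory GRing.Theory Num.Theory.
Import numFieldNormedType.Exports.

Local Open Scope classical_set_scope.
Local Open Scope ring_scope.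

Set Implicit Arguments.
Unset Strict Implicit.
Unset Printing Implicit Defensive.

(** * Cluster points and uniform convergence to zero *)

Lemma cluster_cvg_eq (T U : topologicalType) (F : set_system T) (f : T -> U)
    (p : T) (y : U) : hausdorff_space U -> ProperFilter F -> cluster F p ->
  {for p, continuous f} -> f x @[x --> F] --> y -> f p = y.
Proof.
move=> hU FF Fp cf fy; apply: hU => A B /cf Ap /fy By.
by have [x [Bx Ax]] := Fp _ _ By Ap; exists (f x).
Qed.

(** For a nonincreasing sequence of nonnegative functions, one index per
  tolerance is enough to witness uniform convergence to zero. *)
Lemma uniform_cvg0P (R : realType) (T : choiceType) (A : set T)
    (f : nat -> T -> R) :
  (forall n x, 0 <= f n x) -> (forall n x, f n.+1 x <= f n x) ->
  {uniform A, f @ \oo --> (fun=> 0 : R)} <->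
  (forall e, 0 < e -> exists n, forall x, A x -> f n x < e).
Proof.
move=> f0 fS.
have fle m n x : (m <= n)%N -> f n x <= f m x.
  by apply: (nonincreasing_seqP (f^~ x)).1 => k; exact: fS.
split=> [fu e e0|fu P /uniform_nbhs [E [entE EP]]].
  have : nbhs ((fun=> 0 : R) : {uniform` A -> R})
      [set h : T -> R | forall y, A y -> ball (0 : R) e (h y)].
    apply/uniform_nbhs; exists [set xy | ball xy.1 e xy.2]; split=> //.
    exact: entourage_ball (PosNum e0).
  move=> /fu [n _ /(_ n (leqnn n)) fn]; exists n => x /fn.
  by rewrite /ball /= sub0r normrN ger0_norm.
move: entE; rewrite -entourage_ballE => -[e /= e0 eE].
have [n fn] := fu _ e0.
exists n => // m /= nm; apply: EP => y Ay; apply: eE => /=.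
rewrite /ball /= sub0r normrN ger0_norm//.
exact: le_lt_trans (fle _ _ _ nm) (fn _ Ay).
Qed.

(** * Sequences whose closed sets of uniform convergence are compact *)

Section compactness_from_uniform_convergence.
Context (R : realType) (X : topologicalType) (f : nat -> X -> R).
Hypothesis f_cont : forall n, continuous (f n).
Hypothesis f_ge0 : forall n x, 0 <= f n x.
Hypothesis f_decr : forall n x, f n.+1 x <= f n x.
Hypothesis f_cvg0 : forall x e, 0 < e -> exists n, f n x < e.
Hypothesis f_compact : forall A : set X, closed A ->
  (forall e, 0 < e -> exists n, forall x, A x -> f n x < e) -> compact A.

Let f_le m n x : (m <= n)%N -> f n x <= f m x.
Proof.
by apply: (nonincreasing_seqP (f^~ x)).1 => k; exact: f_decr.
Qed.

Let closed_sublevel n (a : R) : closed [set x | f n x <= a].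
Proof.
apply: (@preimage_closed _ _ (f n) [set y | y <= a]); last exact: closed_le.
by move=> x _; exact: f_cont.
Qed.

(** The map sending x to the sequence (f n x) is perfect over the sequences z
  that have a value below every e > 0. *)
Lemma cluster_of_cvg_values (F : set_system X) (z : nat -> R) :
  ProperFilter F -> (forall n, f n x @[x --> F] --> z n) ->
  (forall e, 0 < e -> exists n, z n < e) -> cluster F !=set0.
Proof.
move=> FF fz z0; apply: contrapT => ncl.
(* The fibre over z is closed, and f converges uniformly on it. *)
pose C := [set x | forall n, f n x = z n].
have cC : compact C.
  apply: f_compact => [|e /z0[n zn]]; last by exists n => x ->.
  have -> : C = \bigcap_n (f n @^-1` [set z n]).
    by apply/seteqP; split=> [x Cx n _|x Cx n]; exact: Cx.
  apply: closed_bigI => n _; apply: preimage_closed => [x _|].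
    exact: f_cont.
  exact: closed_eq.
(* No point of the compact set C is a cluster point of F, so a single A in F
   stays away from all of C. *)
have [A FA CA] : exists2 A, F A & C `<=` ~` closure A.
  have : \forall A \near powerset_filter_from F, C `<=` ~` closure A.
    apply: (compact_near_coveringP _).1 cC _ _ (fun A x => ~ closure A x) _ _.
    move=> x _; have : ~ cluster F x by move=> Fx; apply: ncl; exists x.
    rewrite /cluster /= /meets => /existsNP[A /existsNP[B]].
    move=> /not_implyP[FA /not_implyP[Bx AB]].
    exists (B°, [set W | F W /\ W `<=` A]).
      split; last exact: powerset_filter_fromP.
      by apply: open_nbhs_nbhs; split=> //; exact: open_interior.
    move=> [y W] /= [By [FW WA]] Wy; apply: AB.
    have [t [Wt Bt]] := Wy _ By.
    by exists t; split=> //; exact: WA.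
  move=> [W [WF1 WF2 [A WA]]] WC; exists A; first exact: WF1.
  exact: WC.
pose B k := A `&`
  [set x | forall i, (i <= k)%N -> `|f i x - z i| < k.+1%:R^-1].
have FB k : F (B k).
  apply: filterI => //.
  have : forall m,
      F [set x | forall i, (i < m)%N -> `|f i x - z i| < k.+1%:R^-1].
    elim=> [|m IH]; first by apply: filterS filterT => x _ i.
    have /cvgrPdistC_lt/(_ k.+1%:R^-1) := fz m.
    rewrite invr_gt0 ltr0Sn => /(_ isT) Fm.
    apply: filterS (filterI IH Fm) => x [xm1 xm2] i.
    by rewrite ltnS leq_eqVlt => /orP[/eqP -> //|]; exact: xm1.
  by move=> /(_ k.+1).
have /choice[x xB] : forall k, exists x, B k x.
  by move=> k; exact: filter_ex (FB k).
pose S := closure (range x).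
have fxz i : f i (x k) @[k --> \oo] --> z i.
  apply/cvgrPdistC_lt => e e0.
  have [N _ Ne] := near_infty_natSinv_lt (PosNum e0).
  exists (maxn N i) => // k /=; rewrite geq_max => /andP[Nk ik].
  by apply: lt_trans (Ne _ Nk); exact: (xB k).2.
have cS : compact S.
  apply: f_compact => [|e e0]; first exact: closed_closure.
  have e2 : 0 < e / 2 by rewrite divr_gt0.
  (* Past some rank K one index n serves all the x k, since z n < e / 2; the
     finitely many remaining points are handled one by one. The bound passes
     from the points x k to their closure S. *)
  suff [m fm] : exists m, forall k, f m (x k) <= e / 2.
    exists m => y Sy; apply: (@le_lt_trans _ _ (e / 2)); last first.
      by rewrite ltr_pdivrMr// ltr_pMr// ltr1n.
    apply: (@closed_sublevel m (e / 2)); move: y Sy; apply: closureS.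
    by move=> y [k _ <-] /=.
  have [n zn] := z0 _ e2.
  have : \forall k \near \oo, f n (x k) < e / 2 by exact: (cvgr_lt (z n)).
  move=> [K _ Kn].
  have [m mK] : exists m, forall k, (k < K)%N -> f m (x k) <= e / 2.
    elim: K {Kn} => [|K [m IH]]; first by exists 0%N.
    have [m' fm'] := f_cvg0 (x K) e2.
    exists (maxn m m') => k; rewrite ltnS leq_eqVlt => /orP[/eqP ->|kK].
      by apply: le_trans (ltW fm'); apply: f_le; rewrite leq_maxr.
    by apply: le_trans (IH _ kK); apply: f_le; rewrite leq_maxl.
  exists (maxn m n) => k; have [kK|Kk] := ltnP k K.
    by apply: le_trans (mK _ kK); apply: f_le; rewrite leq_maxl.
  by apply: le_trans (ltW (Kn _ Kk)); apply: f_le; rewrite leq_maxr.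
have [c [_ xc]] : S `&` cluster (x @ \oo) !=set0.
  by apply: cS; exists 0%N => // k _; apply: subset_closure; exists k.
have Cc : C c.
  move=> n; apply: (@cluster_cvg_eq _ R (x @ \oo)) => //.
    exact: f_cont.
  exact: fxz.
apply: (CA _ Cc) => D Dc.
have [|y [Ay Dy]] := xc A D _ Dc; last by exists y.
by exists 0%N => // k _; exact: (xB k).1.
Qed.

(** If U were a neighbourhood of a containing the closure of no neighbourhood of
  a, the sets closure V minus U would generate a filter along which f n
  converges to f n a; its cluster point could only be a. *)
Lemma regular_of_cluster : hausdorff_space X -> @regular_space X.
Proof.
move=> hX a U Ua; apply: contrapT => nU.
pose F := filter_from (nbhs a) (fun V => closure V `&` ~` U).
have FF : ProperFilter F.
  apply: filter_from_proper; first apply: filter_from_filter.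
  - by exists setT; exact: filterT.
  - move=> V W Va Wa; exists (V `&` W); first exact: filterI.
    move=> x [clx Ux]; split; split=> //; move: clx; apply: closureS.
      exact: subIsetl.
    exact: subIsetr.
  - move=> V Va; apply: contrapT => VU; apply: nU; exists V => // x Vx.
    by apply: contrapT => Ux; apply: VU; exists x.
have fF n : f n x @[x --> F] --> f n a.
  apply/cvgrPdistC_lt => e e0; have e2 : 0 < e / 2 by rewrite divr_gt0.
  exists [set x | `|f n x - f n a| <= e / 2].
    have /cvgrPdistC_le/(_ _ e2) := @f_cont n a; exact.
  move=> x [+ _] /=.
  have cl : closed [set x | `|f n x - f n a| <= e / 2].
    apply: (@preimage_closed _ _ (fun x => `|f n x - f n a|)
      [set y | y <= e / 2]).
      move=> y _; apply: cvg_norm; apply: cvgB; first exact: f_cont.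
      exact: cvg_cst.
    exact: closed_le.
  move=> /cl /= /le_lt_trans; apply.
  by rewrite ltr_pdivrMr// ltr_pMr// ltr1n.
have [c Fc] := cluster_of_cvg_values FF fF (f_cvg0 a).
have ac : a = c.
  apply: hX => V W Va Wc.
  suff : closure V c by move=> /(_ _ Wc).
  apply: closed_closure => B Bc.
  have [|y [[Vy _] By]] := Fc (closure V `&` ~` U) B _ Bc; first by exists V.
  by exists y.
have [||y [[_ nUy] Uy]] := Fc (closure setT `&` ~` U) U; last by [].
- by exists setT => //; exact: filterT.
- by rewrite -ac.
Qed.

(** The sets of points sharing the integer parts of (N + 1) * f i x for i <= N
  form countably many cells; by [cluster_of_cvg_values] every point has, for
  some N, a cell covered by finitely many members of the cover. *)
Lemma countable_subcover_of_cluster (C : set (set X)) :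
  (forall U, C U -> open U) -> [set: X] `<=` \bigcup_(U in C) U ->
  exists D, [/\ D `<=` C, countable D & [set: X] `<=` \bigcup_(U in D) U].
Proof.
move=> oC CX.
(* cell (N, s) is the set of points whose code at precision N is s. *)
pose code N x := [seq Num.truncn (f i x * N.+1%:R) | i <- iota 0 N.+1].
pose cell (b : nat * seq nat) := [set x | code b.1 x = b.2].
pose small (D : set (set X)) := D `<=` C /\ finite_set D.
have /choice[D DP] (b : nat * seq nat) : exists D, small D /\
    ((exists2 D', small D' & cell b `<=` \bigcup_(U in D') U) ->
     cell b `<=` \bigcup_(U in D) U).
  have [[D' sD' bD']|nb] :=
    pselect (exists2 D', small D' & cell b `<=` \bigcup_(U in D') U).
    by exists D'.
  by exists set0; split => //; split.
exists (\bigcup_b D b); split.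
- by move=> U [b _ Ub]; exact: (DP b).1.1 Ub.
- apply: bigcup_countable => // b _; apply: finite_set_countable.
  exact: (DP b).1.2.
move=> a _.
suff [N [D' sD' ND']] : exists N, exists2 D', small D' &
    cell (N, code N a) `<=` \bigcup_(U in D') U.
  have [|U DU Ua] := (DP (N, code N a)).2 _ a erefl; first by exists D'.
  by exists U => //; exists (N, code N a).
(* Otherwise the points with values near those of a, minus finite unions from
   the cover, generate a proper filter, whose cluster point is not covered. *)
apply: contrapT => nD.
pose T (b : nat * set (set X)) := [set y | (forall i, (i <= b.1)%N ->
  `|f i y - f i a| <= b.1.+1%:R^-1) /\ ~ (\bigcup_(U in b.2) U) y].
pose F := filter_from [set b : nat * set (set X) | small b.2] T.
have FF : ProperFilter F.
  apply: filter_from_proper; first apply: filter_from_filter.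
  - by exists (0%N, set0); split.
  - move=> [N D1] [M D2] /= [D1C fD1] [D2C fD2].
    exists (maxn N M, D1 `|` D2) => /=.
      by split; [rewrite subUset|rewrite finite_setU].
    move=> y [/= yNM yD]; split; split=> /=.
    + move=> i iN; apply: (le_trans (yNM i _)).
        by rewrite (leq_trans iN)// leq_maxl.
      by rewrite lef_pV2 ?posrE// ler_nat ltnS leq_maxl.
    + by move=> [U DU Uy]; apply: yD; exists U => //; left.
    + move=> i iN; apply: (le_trans (yNM i _)).
        by rewrite (leq_trans iN)// leq_maxr.
      by rewrite lef_pV2 ?posrE// ler_nat ltnS leq_maxr.
    + by move=> [U DU Uy]; apply: yD; exists U => //; right.
  - move=> [N D'] /= sD'; apply: contrapT => T0; apply: nD; exists N, D' => //.
    move=> y /= ya; apply: contrapT => yD; apply: T0.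
    exists y; split => //= i iN.
    have itr :
        Num.truncn (f i y * N.+1%:R) = Num.truncn (f i a * N.+1%:R).
      have := congr1 (fun s => nth 0%N s i) ya.
      by rewrite /code !(nth_map 0%N) ?size_iota// nth_iota.
    have tr x : 0 <= f i x * N.+1%:R by rewrite mulr_ge0.
    have := truncn_itv (tr y); rewrite itr => /andP[y1 y2].
    have /andP[a1 a2] := truncn_itv (tr a).
    rewrite -[leRHS]mul1r ler_pdivlMr// -[X in _ * X <= _]ger0_norm//.
    rewrite -normrM mulrBl ler_norml; move: y1 y2 a1 a2.
    by rewrite -natr1; lra.
have fF n : f n x @[x --> F] --> f n a.
  apply/cvgrPdistC_lt => e e0.
  have [N _ Ne] := near_infty_natSinv_lt (PosNum e0).
  exists (maxn N n, set0) => /=; first by split.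
  move=> y [/= yN _]; apply: le_lt_trans (Ne (maxn N n) _).
    by apply: yN; rewrite leq_maxr.
  by rewrite /= leq_maxl.
have [c Fc] := cluster_of_cvg_values FF fF (f_cvg0 a).
have [U CU Uc] := CX c I.
have [||y [[_ nUy] Uy]] := Fc (T (0%N, [set U])) U.
- by exists (0%N, [set U]) => //; split; [move=> V ->|exact: finite_set1].
- by apply: open_nbhs_nbhs; split => //; exact: oC.
by apply: nUy; exists U.
Qed.

End compactness_from_uniform_convergence.

(** * Regular Lindelöf spaces are normal *)

(** Enumeration of a countable, possibly empty, set: the default value x0 fills
  the unused ranks. *)
Lemma countable_enum (T : Type) (D : set T) (x0 : T) : countable D ->
  exists s : nat -> T, (forall n, D (s n) \/ s n = x0) /\
    (forall x, D x -> exists n, s n = x).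
Proof.
move=> /countable_injP[e einj].
have /choice[s sP] (n : nat) : exists y, (D y \/ y = x0) /\
    (forall x, D x -> e x = n -> y = x).
  have [[y Dy en]|nD] := pselect (exists2 y, D y & e y = n).
    exists y; split; first by left.
    by move=> x Dx xn; apply: einj; rewrite ?inE// en.
  exists x0; split; first by right.
  by move=> x Dx xn; exfalso; apply: nD; exists x.
exists s; split=> [n|x Dx]; first exact: (sP n).1.
by exists (e x); exact: (sP (e x)).2.
Qed.

Lemma lindelof_countable_shrink (X : topologicalType) (A B : set X) :
  lindelof_space X -> closed A -> closed B -> A `&` B = set0 ->
  exists u : nat -> set X, [/\ forall n, open (u n),
    A `<=` \bigcup_n u n & forall n, closure (u n) `&` B = set0].
Proof.
move=> [hX rX lX] clA clB AB.
pose C := [set U : set X |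
  open U /\ (closure U `&` B = set0 \/ U `&` A = set0)].
have [||D [DC /(countable_enum set0)[s [Ds sD]] DX]] := lX C.
- by move=> U [].
- move=> x _; have [Ax|nAx] := pselect (A x); last first.
    exists (~` A) => //; split; first by rewrite openC.
    by right; exact: setICl.
  have : nbhs x (~` B).
    apply: open_nbhs_nbhs; split; first by rewrite openC.
    by move=> Bx; move: AB; rewrite -subset0 => /(_ x); exact.
  move=> /rX[V Vx VB]; exists V°; last exact: Vx.
  split; first exact: open_interior.
  left; rewrite -subset0 => y [Vy]; apply: VB; move: y Vy.
  by apply: closureS; exact: interior_subset.
have /choice[u uP] (n : nat) : exists u : set X,
    [/\ open u, closure u `&` B = set0 & s n `&` A `<=` u].
  have s0 : exists u : set X,
      [/\ open u, closure u `&` B = set0 & set0 `<=` u].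
    by exists set0; split; [exact: open0|rewrite closure0 set0I|].
  have [/DC[osn [snB|snA]]|->] := Ds n.
  - by exists (s n); split => // x [].
  - by rewrite snA.
  - by rewrite set0I.
exists u; split=> [n|x Ax|n]; [by have [] := uP n| |by have [] := uP n].
have [U DU Ux] := DX x I; have [n snU] := sD _ DU.
by exists n => //; have [_ _] := uP n; apply; rewrite snU.
Qed.

Lemma lindelof_normal (R : realType) (X : topologicalType) :
  lindelof_space X -> normal_space X.
Proof.
move=> lX; apply/(@normal_openP R) => A B clA clB AB.
have [u [ou Au uB]] := lindelof_countable_shrink lX clA clB AB.
have BA : B `&` A = set0 by rewrite setIC.
have [v [ov Bv vA]] := lindelof_countable_shrink lX clB clA BA.
(* W a b removes from each a n the closures of the first n + 1 sets b k; the
   two sets W u v and W v u are then disjoint, by comparing ranks. *)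
pose W (a b : nat -> set X) :=
  \bigcup_n (a n `\` \bigcup_(k in `I_n.+1) closure (b k)).
have oW a b : (forall n, open (a n)) -> open (W a b).
  move=> oa; apply: bigcup_open => n _; apply: openI => //.
  rewrite openC; apply: closed_bigcup; first exact: finite_II.
  by move=> k _; exact: closed_closure.
have AW a b E : E `<=` \bigcup_n a n ->
    (forall n, closure (b n) `&` E = set0) -> E `<=` W a b.
  move=> Ea bE x Ex; have [n _ ax] := Ea _ Ex.
  exists n => //; split => // -[k _ bx].
  by have := bE k; rewrite -subset0 => /(_ x); exact.
exists (W u v), (W v u); split; [exact: oW|exact: oW|exact: AW|exact: AW|].
rewrite -subset0 => x [[n _ [un nv]] [m _ [vm mu]]].
have [nm|mn] := leqP n m.
  by apply: mu; exists n => //; exact: subset_closure.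
by apply: nv; exists m => /=; [exact: ltnW|exact: subset_closure].
Qed.

(** * The Čech-Stone compactification *)

(** Continuous functions from T to the unit interval of R, as a subtype of
  T -> R. *)
Definition unit_map (R : realType) (T : topologicalType) : Type :=
  set_type [set g : T -> R | continuous g /\ forall x, 0 <= g x <= 1].

HB.instance Definition _ (R : realType) (T : topologicalType) :=
  Choice.on (unit_map R T).

Section unit_maps.
Context (R : realType).

Lemma unit_map_cont (T : topologicalType) (g : unit_map R T) :
  continuous (val g).
Proof. exact: (set_mem (valP g)).1. Qed.

Lemma unit_map_itv (T : topologicalType) (g : unit_map R T) x :
  0 <= val g x <= 1.
Proof. exact: (set_mem (valP g)).2. Qed.

Lemma unit_map_separator (T : topologicalType) (U : set T) (x : T) :
  completely_regular_space T -> open U -> U x ->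
  exists g : unit_map R T, val g x = 0 /\ forall y, ~ U y -> val g y = 1.
Proof.
move=> crT oU Ux.
have /(@uniform_separatorP T R)[g [cg g01 gx gU]] :
    uniform_separator [set x] (~` U).
  apply: crT; first by rewrite closedC.
  by apply.
have gP : [set g : T -> R | continuous g /\ forall x, 0 <= g x <= 1] g.
  split=> // y; have : range g (g y) by exists y.
  by move=> /g01 /=; rewrite in_itv.
exists (SigSub (mem_set gP)); split; first by apply: gx; exists x.
by move=> y nUy; apply: gU; exists y.
Qed.

Lemma unit_map_eq (T : topologicalType) (x y : T) :
  tychonoff_space T -> (forall g : unit_map R T, val g x = val g y) -> x = y.
Proof.
move=> [hT crT] gxy; apply: contrapT => /eqP xy.
have [||g [gx gy]] := @unit_map_separator T (~` [set y]) x crT.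
- rewrite openC; apply: accessible_closed_set1; exact: hausdorff_accessible.
- by move=> /= /eqP; apply/negP.
have := gxy g; rewrite gx gy; last exact.
by move=> /esym/eqP; rewrite oner_eq0.
Qed.

Lemma unit_map_pull (S T : topologicalType) (c : S -> T) (g : unit_map R T) :
  continuous c -> exists g' : unit_map R S, forall x, val g' x = val g (c x).
Proof.
move=> cc.
have gP : [set g : S -> R | continuous g /\ forall x, 0 <= g x <= 1]
    (val g \o c).
  split=> [x|x]; last exact: unit_map_itv.
  by apply: continuous_comp; [exact: cc|exact: unit_map_cont].
by exists (SigSub (mem_set gP)).
Qed.

End unit_maps.

Lemma dense_preimage_proper (T U : topologicalType) (c : T -> U) (p : U) :
  dense (range c) -> ProperFilter (filter_from (nbhs p) (preimage c)).
Proof.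
move=> dc; apply: filter_from_proper; first apply: filter_from_filter.
- by exists setT; exact: filterT.
- by move=> V W Vp Wp; exists (V `&` W); first exact: filterI.
move=> V; rewrite nbhsE => -[W [oW Wp] WV].
have [|y [Wy [x _ cx]]] := dc W _ oW; first by exists p.
by exists x; apply: WV; rewrite /= cx.
Qed.

Section stone_cech.
Context (R : realType) (X : topologicalType).

(** The canonical map of X to the cube indexed by its unit maps. *)
Definition eval_map (x : X) : {ptws (unit_map R X) -> R} := fun g => val g x.

(** The closure of the image of X in the cube, with the subtype topology. *)
Definition stone_cech : topologicalType := set_type (closure (range eval_map)).

Definition stone_cech_map (x : X) : stone_cech :=
  SigSub (mem_set (subset_closure (imageT eval_map x))).

(** The coordinate of index g, which is the extension of g to [stone_cech]. *)
Definition coord (g : unit_map R X) (p : stone_cech) : R := (val p : _ -> R) g.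

Lemma coord_map g x : coord g (stone_cech_map x) = val g x.
Proof. by []. Qed.

Lemma coord_cont g : continuous (coord g).
Proof.
move=> p; apply: (@continuous_comp _ {ptws (unit_map R X) -> R} _
  (val : stone_cech -> _) (@proj _ (fun=> R) g)).
  exact: initial_continuous.
exact: proj_continuous.
Qed.

Lemma coord_inj p q : (forall g, coord g p = coord g q) -> p = q.
Proof. by move=> pq; apply: val_inj; apply/funext => g; exact: pq. Qed.

Lemma stone_cech_hausdorff : hausdorff_space stone_cech.
Proof.
move=> p q pq; apply: coord_inj => g; apply/esym.
by apply: (@cluster_cvg_eq _ R (nbhs p)) => //; exact: coord_cont.
Qed.

Lemma stone_cech_nbhs (p : stone_cech) (A : set stone_cech) : nbhs p A ->
  exists W : set {ptws (unit_map R X) -> R},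
    [/\ open W, W (val p) & forall q : stone_cech, W (val q) -> A q].
Proof. by move=> [_ [[W oW <-] Wp WA]]; exists W. Qed.

Lemma stone_cech_map_cont : continuous stone_cech_map.
Proof.
suff ce : continuous eval_map.
  move=> x A /stone_cech_nbhs[W [oW Wx WA]].
  have : nbhs x (eval_map @^-1` W) by apply: ce; exact: open_nbhs_nbhs.
  by apply: filterS => y Wy; exact: (WA (stone_cech_map y)).
move=> x; apply/cvg_sup => g A.
case=> _ [[B oB <-] Bgx BA].
have : nbhs x (val g @^-1` B).
  by apply: unit_map_cont; exact: open_nbhs_nbhs.
by apply: filterS => y; exact: BA.
Qed.

Lemma stone_cech_dense : dense (range stone_cech_map).
Proof.
move=> O [p Op] oO.
have [W [oW Wp WO]] := stone_cech_nbhs (open_nbhs_nbhs (conj oO Op)).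
have [|y [[x _ <-] Wx]] := set_mem (valP p) W; first exact: open_nbhs_nbhs.
by exists (stone_cech_map x); split; [exact: WO|exists x].
Qed.

Lemma stone_cech_compact : compact [set: stone_cech].
Proof.
have cK : compact (closure (range eval_map)).
  pose Q := [set p : {ptws (unit_map R X) -> R} |
    forall g, `[0, 1]%classic (p g)].
  have cQ : compact Q.
    apply: (@tychonoff _ (fun _ : unit_map R X => R) (fun=> `[0, 1]%classic)).
    by move=> g; exact: segment_compact.
  apply: (subclosed_compact _ cQ); first exact: closed_closure.
  have clQ : closed Q.
    apply: (compact_closed _ cQ).
    exact: (@hausdorff_product _ (fun _ : unit_map R X => R)).
  move=> p pK; apply: clQ; move: p pK; apply: closureS => _ [x _ <-] g /=.
  by rewrite in_itv /=; exact: unit_map_itv.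
move=> F FF _; pose v := (val : stone_cech -> {ptws (unit_map R X) -> R}).
have vK : F (v @^-1` closure (range eval_map)).
  by apply: filterS filterT => q _; have /set_mem := valP q; exact.
have [p [Kp pF]] := cK (v @ F) _ vK.
exists (SigSub (mem_set Kp)); split => // A B FA /stone_cech_nbhs[W [oW Wp WB]].
have [|y [[q Aq <-] Wq]] := pF (v @` A) W _ (open_nbhs_nbhs (conj oW Wp)).
  suff : F (v @^-1` (v @` A)) by [].
  by apply: filterS FA => q Aq; exists q.
by exists q; split => //; exact: WB.
Qed.

Lemma stone_cech_embedding :
  tychonoff_space X -> topological_embedding stone_cech_map.
Proof.
move=> tX; split; first exact: stone_cech_map_cont.
  move=> x y xy; apply: (@unit_map_eq R) => // g.
  by rewrite -!coord_map xy.
move=> U oU.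
exists (\bigcup_(g in [set g : unit_map R X | forall y, ~ U y -> val g y = 1])
          (coord g @^-1` [set r | r < 1])).
  apply: bigcup_open => g _; apply: open_comp; last exact: open_lt.
  by move=> p _; exact: coord_cont.
apply/seteqP; split=> [_ [x Ux <-]|y [[g gU] /= + [x _ xy]]].
  split; last by exists x.
  have [g [gx gU]] := unit_map_separator R tX.2 oU Ux.
  by exists g => //=; rewrite coord_map gx ltr01.
rewrite -xy coord_map => gx1; exists x => //; apply: contrapT => nUx.
by move: gx1; rewrite gU// ltxx.
Qed.

(** The map h to another compactification K sends p to the point whose value
  under each unit map g of K is the coordinate of p at the composite of g with
  c; unit maps separate the points of K from its closed sets, so h is well
  defined and continuous. *)
Lemma stone_cech_compactification :
  tychonoff_space X -> cech_stone_compactification stone_cech_map.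
Proof.
move=> tX; split.
  split; [exact: stone_cech_compact|exact: stone_cech_hausdorff|
    exact: stone_cech_embedding|exact: stone_cech_dense].
move=> K c [cptK hK [cc _ _] _].
have tK : tychonoff_space K.
  split=> //; apply: (@normal_completely_regular R).
    exact: compact_normal.
  exact: hausdorff_accessible.
have /choice[pull pullE] : forall g : unit_map R K, exists g' : unit_map R X,
    forall x, val g' x = val g (c x) by move=> g; exact: unit_map_pull.
(* A suitable value at p is any cluster point of c along the trace on X of the
   neighbourhood filter of p. *)
have /choice[h hE] : forall p : stone_cech, exists y : K,
    forall g : unit_map R K, val g y = coord (pull g) p.
  move=> p; pose F := filter_from (nbhs p) (preimage stone_cech_map).
  have FF : ProperFilter F := dense_preimage_proper p stone_cech_dense.
  have [|y [_ yF]] := cptK (c @ F) _; first exact: filterT.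
  exists y => g; apply: (@cluster_cvg_eq _ R (c @ F)) => //.
    exact: unit_map_cont.
  move=> V /coord_cont Vp; exists (coord (pull g) @^-1` V) => // x /=.
  by rewrite coord_map pullE.
exists h => [p U|x]; last first.
  by apply: (@unit_map_eq R _ _ _ tK) => g; rewrite hE coord_map pullE.
rewrite nbhsE => -[V [oV Vp] VU].
have [g [g0 gV]] := unit_map_separator R tK.2 oV Vp.
have : nbhs p (coord (pull g) @^-1` [set r | r < 1]).
  apply: coord_cont; apply: open_nbhs_nbhs; split; first exact: open_lt.
  by rewrite /= -hE g0 ltr01.
apply: filterS => q /=; rewrite -hE => gq; apply: VU; apply: contrapT => nVq.
by move: gq; rewrite gV// ltxx.
Qed.

End stone_cech.

(** * From the sequence to Čech-completeness and the Lindelöf property *)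

Lemma cech_complete_lindelof_of_seq (R : realType) (X : topologicalType)
    (f : nat -> X -> R) : hausdorff_space X ->
  (forall n, continuous (f n)) -> (forall n x, 0 <= f n x <= 1) ->
  (forall n x, f n.+1 x <= f n x) ->
  (forall x e, 0 < e -> exists n, f n x < e) ->
  (forall A, closed A ->
    (forall e, 0 < e -> exists n, forall x, A x -> f n x < e) -> compact A) ->
  cech_complete_space X /\ lindelof_space X.
Proof.
move=> hX fc f01 fS f0 fK.
have fge0 n x : 0 <= f n x by have /andP[] := f01 n x.
have lX : lindelof_space X.
  split=> //; first exact: (@regular_of_cluster R X f).
  exact: (@countable_subcover_of_cluster R X f).
have tX : tychonoff_space X.
  split=> //; apply: (@normal_completely_regular R).
    exact: (@lindelof_normal R).
  exact: hausdorff_accessible.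
split=> //; split=> //.
exists (stone_cech R X), (@stone_cech_map R X).
split; first exact: stone_cech_compactification.
have /choice[u uE] (n : nat) : exists u : unit_map R X, val u = f n.
  have fP :
      [set g : X -> R | continuous g /\ forall x, 0 <= g x <= 1] (f n).
    by split; [exact: fc|exact: f01].
  by exists (SigSub (mem_set fP)).
(* The points where, for every k, the extension of some f n is below 1/(k+1). *)
exists (fun k => \bigcup_n (coord (u n) @^-1` [set r | r < k.+1%:R^-1])).
  move=> k; apply: bigcup_open => n _; apply: open_comp; last exact: open_lt.
  by move=> p _; exact: coord_cont.
apply/seteqP; split=> [p [x _ <-] k _|p pU].
  have [|n fn] := f0 x k.+1%:R^-1; first by rewrite invr_gt0.
  by exists n => //=; rewrite coord_map uE.
pose F := filter_from (nbhs p) (preimage (@stone_cech_map R X)).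
have FF : ProperFilter F := dense_preimage_proper p (@stone_cech_dense R X).
have [||x Fx] :=
  cluster_of_cvg_values fc fS f0 fK FF (z := fun n => coord (u n) p).
- move=> n V /coord_cont Vp; exists (coord (u n) @^-1` V) => // x /=.
  by rewrite coord_map uE.
- move=> e e0; have [k _ ke] := near_infty_natSinv_lt (PosNum e0).
  have [n _ /= pn] := pU k I; exists n; apply: lt_trans pn _.
  by apply: (ke k) => /=.
exists x => //; apply: (@cluster_cvg_eq _ _ F) => //.
- exact: stone_cech_hausdorff.
- exact: stone_cech_map_cont.
by move=> V Vp; exists V.
Qed.

(** * From Čech-completeness and the Lindelöf property to the sequence *)

Section weighted_supremum.
Context (R : realType) (T : topologicalType).
Implicit Types (g : nat -> T -> R) (x : T).

(** Supremum of the g i x with weights 1/(i+1); when the g i are continuous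
  with values in [0, 1], the weights make it continuous in x. *)
Definition wsup g x : R := sup (range (fun i => i.+1%:R^-1 * g i x)).

Lemma wsup_le g x b : (forall i, i.+1%:R^-1 * g i x <= b) -> wsup g x <= b.
Proof.
move=> gb; apply: ge_sup; first by exists (1%:R^-1 * g 0%N x), 0%N.
by move=> _ [i _ <-].
Qed.

Lemma wterm_itv g x i : (forall i x, 0 <= g i x <= 1) ->
  0 <= i.+1%:R^-1 * g i x <= i.+1%:R^-1.
Proof.
move=> g01; have /andP[g0 g1] := g01 i x.
by rewrite mulr_ge0//= ler_piMr.
Qed.

Lemma invS_le1 i : i.+1%:R^-1 <= 1 :> R.
Proof. by rewrite invf_le1// ler1n. Qed.

Lemma wsup_ge g x i : (forall i x, 0 <= g i x <= 1) ->
  i.+1%:R^-1 * g i x <= wsup g x.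
Proof.
move=> g01; apply: ub_le_sup; last by exists i.
exists 1 => _ [j _ <-]; have /andP[_ gj] := wterm_itv x j g01.
exact: le_trans gj (invS_le1 j).
Qed.

Lemma wsup_itv g x : (forall i x, 0 <= g i x <= 1) -> 0 <= wsup g x <= 1.
Proof.
move=> g01; apply/andP; split.
  have /andP[g0 _] := wterm_itv x 0%N g01.
  exact: le_trans g0 (wsup_ge x 0%N g01).
apply: wsup_le => i; have /andP[_ gi] := wterm_itv x i g01.
exact: le_trans gi (invS_le1 i).
Qed.

Lemma wsup_cont g : (forall i x, 0 <= g i x <= 1) ->
  (forall i, continuous (g i)) -> continuous (wsup g).
Proof.
move=> g01 cg x; apply/cvgrPdistC_le => e e0.
have [N _ Ne] := near_infty_natSinv_lt (PosNum e0).
have : forall m, \forall y \near x,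
    forall i, (i < m)%N -> `|g i y - g i x| <= e.
  elim=> [|m IH]; first by apply: filterS filterT => y _ i.
  have /cvgrPdistC_le/(_ _ e0) gm := @cg m x.
  apply: filterS (filterI IH gm) => y [ym1 ym2] i.
  by rewrite ltnS leq_eqVlt => /orP[/eqP -> //|]; exact: ym1.
move=> /(_ N); apply: filterS => y yN.
have cmp a b : (forall i, (i < N)%N -> `|g i a - g i b| <= e) ->
    wsup g a <= wsup g b + e.
  move=> ab; apply: wsup_le => i; have [iN|Ni] := ltnP i N.
    have := ab _ iN; rewrite ler_norml => /andP[_ gab].
    rewrite -lerBlDl; apply: (le_trans (lerB (lexx _) (wsup_ge b i g01))).
    rewrite -mulrBr; apply: (@le_trans _ _ (i.+1%:R^-1 * e)).
      by rewrite ler_wpM2l.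
    by rewrite ler_piMl ?invS_le1// ltW.
  have /andP[_ ga] := wterm_itv a i g01.
  have /andP[b0 _] := wsup_itv b g01.
  by apply: (le_trans ga); apply: (le_trans (ltW (Ne _ Ni))); rewrite lerDr.
rewrite ler_distl lerBlDr; apply/andP; split; apply: cmp => //.
by move=> i iN; rewrite distrC; exact: yN.
Qed.

End weighted_supremum.

(** A Lindelöf subspace has a cozero neighbourhood inside each of its open
  neighbourhoods in a compactification. *)
Lemma cozero_of_open (R : realType) (X K : topologicalType) (c : X -> K)
    (U : set K) : compactification c -> lindelof_space X -> open U ->
  range c `<=` U ->
  exists h : K -> R, [/\ continuous h, forall p, 0 <= h p <= 1,
    forall x, 0 < h (c x) & forall p, ~ U p -> h p = 0].
Proof.
move=> [cptK hK [cc _ _] _] [_ _ lX] oU cU.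
have crK : completely_regular_space K.
  apply: (@normal_completely_regular R).
    exact: compact_normal.
  exact: hausdorff_accessible.
pose bump (V : set X) (g : K -> R) := [/\ continuous g,
  forall p, 0 <= g p <= 1, V = [set x | 0 < g (c x)] &
  forall p, ~ U p -> g p = 0].
pose C := [set V : set X | exists g, bump V g].
have [||D [DC /(countable_enum set0)[s [Ds sD]] DX]] := lX C.
- move=> V [g [cg _ -> _]]; apply: (@open_comp _ _ (g \o c) [set r | 0 < r]).
    by move=> x _; apply: continuous_comp; [exact: cc|exact: cg].
  exact: open_gt.
- move=> x _; have [|g [gx gU]] := @unit_map_separator R K U (c x) crK oU.
    by apply: cU; exists x.
  exists [set y | 0 < 1 - val g (c y)]; last by rewrite /= gx subr0.
  exists (fun p => 1 - val g p); split=> //.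
  + by move=> p; apply: cvgB; [exact: cvg_cst|exact: unit_map_cont].
  + by move=> p; have := unit_map_itv g p; lra.
  + by move=> p /gU ->; rewrite subrr.
have /choice[g gP] (n : nat) : exists g, bump (s n) g.
  have [/DC //|->] := Ds n.
  exists (fun=> 0); split=> //.
  - by move=> p; exact: cvg_cst.
  - by move=> p; rewrite lexx ler01.
  - by apply/esym; rewrite -subset0 => x /=; rewrite ltxx.
have g01 i p : 0 <= g i p <= 1 by have [_ + _ _] := gP i.
exists (wsup g); split.
- by apply: wsup_cont => // i; have [] := gP i.
- by move=> p; exact: wsup_itv.
- move=> x; have [V DV Vx] := DX x I; have [n snV] := sD _ DV.
  apply: lt_le_trans (wsup_ge (c x) n g01).
  have [_ _ gn _] := gP n; move: Vx; rewrite -snV gn /= => gx.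
  by rewrite mulr_gt0.
- move=> p nUp; apply/eqP; rewrite eq_le; have /andP[-> _] := wsup_itv p g01.
  rewrite andbT; apply: wsup_le => i.
  by have [_ _ _ ->] := gP i; rewrite ?mulr0.
Qed.

Lemma seq_of_cech_complete_lindelof (R : realType) (X : topologicalType) :
  cech_complete_space X -> lindelof_space X ->
  exists f : nat -> X -> R, [/\ forall n, continuous (f n),
    forall n x, 0 <= f n x <= 1, forall n x, f n.+1 x <= f n x,
    forall x e, 0 < e -> exists n, f n x < e &
    forall A, closed A ->
      (forall e, 0 < e -> exists n, forall x, A x -> f n x < e) -> compact A].
Proof.
move=> [tX [K [c [[cK _] [U oU cU]]]]] lX.
have /choice[h hP] (k : nat) : exists h : K -> R, [/\ continuous h,
    forall p, 0 <= h p <= 1, forall x, 0 < h (c x) &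
    forall p, ~ U k p -> h p = 0].
  apply: cozero_of_open => //.
  by rewrite cU => p; exact.
have [cptK hK [cc cinj copen] _] := cK.
pose g m k (x : X) := Num.max 0 (1 - m%:R * h k (c x)).
have hc k x : 0 < h k (c x) by have [] := hP k.
have g01 m k x : 0 <= g m k x <= 1.
  rewrite /g le_max lexx /= ge_max ler01 /= gerBl mulr_ge0//.
  exact: ltW.
have gc m k : continuous (g m k).
  move=> x; apply: (@continuous_max _ _ (fun=> 0)
    (fun x => 1 - m%:R * h k (c x))); first exact: cvg_cst.
  apply: cvgB; first exact: cvg_cst.
  apply: cvgM; first exact: cvg_cst.
  by apply: continuous_comp; [exact: cc|have [+ _ _ _] := hP k; apply].
exists (fun m => wsup (g m)); split.
- by move=> m; exact: wsup_cont.
- by move=> m x; exact: wsup_itv.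
- move=> m x; apply: wsup_le => i; apply: le_trans (wsup_ge x i (g01 m)).
  rewrite ler_wpM2l//; apply: le_max2; first exact: lexx.
  by rewrite lerB// ler_wpM2r ?(ltW (hc i x))// ler_nat.
- move=> x e e0; have e2 : 0 < e / 2 by rewrite divr_gt0.
  have [N _ Ne] := near_infty_natSinv_lt (PosNum e2).
  have [m hm] : exists m : nat, forall k, (k < N)%N -> 1 <= m%:R * h k (c x).
    elim: N {Ne} => [|N [m IH]]; first by exists 0%N.
    have [m' hm'] : exists m' : nat, 1 <= m'%:R * h N (c x).
      exists (Num.truncn (h N (c x))^-1).+1.
      rewrite -ler_pdivrMr ?hc// div1r; apply: ltW.
      have : 0 <= (h N (c x))^-1 by rewrite invr_ge0 ltW.
      by move=> /truncn_itv /andP[].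
    exists (maxn m m') => k; rewrite ltnS leq_eqVlt => /orP[/eqP ->|kN].
      apply: le_trans hm' _.
      by rewrite ler_wpM2r ?(ltW (hc _ _))// ler_nat leq_maxr.
    apply: le_trans (IH _ kN) _.
    by rewrite ler_wpM2r ?(ltW (hc _ _))// ler_nat leq_maxl.
  exists m; apply: (@le_lt_trans _ _ (e / 2)); last lra.
  apply: wsup_le => i; have [iN|Ni] := ltnP i N.
    rewrite /g max_l ?mulr0 ?(ltW e2)//.
    by rewrite subr_le0 hm.
  have /andP[_ gi] := wterm_itv x i (g01 m).
  by apply: le_trans gi _; apply: ltW; exact: Ne.
(* A cluster point p in K of a filter on A either comes from X, and is then a
   cluster point in A, or is a zero of some h k, which uniformity excludes. *)
move=> A clA uA F FF FA.
have [|p [_ pF]] := cptK (c @ F) _; first exact: filterT.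
have [[x _ xp]|np] := pselect (range c p).
  suff Fx : cluster F x.
    exists x; split => //; apply: clA => B Bx.
    exact: Fx.
  move=> B V FB; rewrite nbhsE => -[W [oW Wx] WV].
  have [W' oW' cW] := copen _ oW.
  have W'p : nbhs p W'.
    apply: open_nbhs_nbhs; split=> //; rewrite -xp.
    have : (c @` W) (c x) by exists x.
    by rewrite cW => -[].
  have [|y [[b Bb by_] W'y]] := pF (c @` B) W' _ W'p.
    suff : F (c @^-1` (c @` B)) by [].
    by apply: filterS FB => b Bb; exists b.
  exists b; split => //; apply: WV.
  have : (c @` W) y by rewrite cW; split => //; exists b.
  by move=> [w Ww wy]; rewrite (cinj b w)// by_ wy.
have [k nUk] : exists k, ~ U k p.
  apply: contrapT => nk; apply: np; rewrite cU => k _.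
  by apply: contrapT => nUk; apply: nk; exists k.
have [ch _ _ h0] := hP k.
(* At index m the weighted term of rank k is below half its weight on A, so
   m * h k > 1/2 on c(A), whereas h k vanishes at p. *)
have [|m um] := uA (k.+1%:R^-1 * 2^-1); first by rewrite mulr_gt0.
have pV : nbhs p [set q | m%:R * h k q < 2^-1].
  have cmh : continuous (fun q => m%:R * h k q).
    by move=> q; apply: cvgM; [exact: cvg_cst|exact: ch].
  apply: (cmh p [set r | r < 2^-1]); apply: open_nbhs_nbhs; split.
    exact: open_lt.
  by rewrite /= h0// mulr0 invr_gt0.
have [|y [[a Aa ay] ha]] := pF (c @` A) _ _ pV.
  suff : F (c @^-1` (c @` A)) by [].
  by apply: filterS FA => b Ab; exists b.
have := um _ Aa; have := wsup_ge a k (g01 m) => ga1 ga2; exfalso.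
have := le_lt_trans ga1 ga2; rewrite ltr_pM2l// /g gt_max => /andP[_].
by move: ha; rewrite /= -ay; lra.
Qed.

Theorem theorem5p2 (R : realType) (X : topologicalType)
    (hX : hausdorff_space X) :
  (cech_complete_space X /\ lindelof_space X) <->
  exists f : nat -> X -> R,
    (forall n, continuous (f n)) /\
    (forall n x, 0 <= f n x <= 1) /\
    (forall n x, f n.+1 x <= f n x) /\
    (forall x, f ^~ x @ \oo --> (0 : R)) /\
    (forall A : set X, closed A -> ~ compact A ->
       ~ {uniform A, f @ \oo --> (fun=> 0 : R)}).
Proof.
split=> [[ccX lX]|[f [fc [f01 [fS [f0 fu]]]]]].
  have [f [fc f01 fS f0 fK]] := seq_of_cech_complete_lindelof R ccX lX.
  have fge0 n x : 0 <= f n x by have /andP[] := f01 n x.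
  exists f; split=> //; split=> //; split=> //; split=> [x|A clA nA].
    apply/cvgrPdistC_lt => e e0; have [n fn] := f0 x e e0.
    exists n => // m /= nm; rewrite subr0 ger0_norm//.
    apply: le_lt_trans fn.
    by apply: (nonincreasing_seqP (f^~ x)).1 => // k; exact: fS.
  by move=> /(uniform_cvg0P _ fge0 fS) /(fK _ clA).
have fge0 n x : 0 <= f n x by have /andP[] := f01 n x.
apply: (@cech_complete_lindelof_of_seq R X f) => //.
  move=> x e e0; have [n _ fn] := cvgr_lt _ (f0 x) _ e0.
  by exists n; apply: (fn n) => /=.
move=> A clA uA; apply: contrapT => nA; apply: (fu A) => //.
exact/(uniform_cvg0P _ fge0 fS).
Qed.
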